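(* Let $(\mathfrak a,B)$ be a pair over a field $F$ of characteristic $0$ satisfying condition (Q), $F'/F$ a quadratic extension, and let $X$ be an absolutely irreducible $(\mathfrak a',B')$-module with $\mathrm{FS}_F(X)\neq0$, where $(\mathfrak a',B')$ is the base change of $(\mathfrak a,B)$ to $F'$. Assume that there exists an absolutely irreducible rational $B'$-module $X_0$ which occurs in $X$ with multiplicity one and for which $\mathrm{FS}_F(X_0)\neq0$. Then $$\mathrm{FS}_F(X)=\mathrm{FS}_F(X_0).$$
   Context: A pair $(\mathfrak a,B)$ over $F$ consists of a reductive linear algebraic group $B$ over $F$ (not necessarily connected; connected components assumed geometrically connected), a finite-dimensional Lie algebra $\mathfrak a$ over $F$, a monomorphism $\mathfrak b=\mathrm{Lie}(B)\to\mathfrak a$, and an action of $B$ on $\mathfrak a$ whose differential is the action of $\mathfrak b$. An $(\mathfrak a,B)$-module is a locally finite rational $B$-module over $F$ with a $B$-equivariant action of $\mathfrak a$ whose restriction to $\mathfrak b$ is the derivative of the $B$-action; it is absolutely irreducible if it is irreducible over every extension field. Condition (Q): there is a finite subgroup $B_0\subseteq B$ such that $B_0\to\pi_0(B\otimes_F\overline F)$ is surjective. For an absolutely irreducible $(\mathfrak a',B')$-module $X$, let $Y=\mathrm{Res}_{F'/F}X$ be $X$ regarded as an $(\mathfrak a,B)$-module over $F$. The Frobenius–Schur indicator is $\mathrm{FS}_F(X)=1$ if $\mathrm{End}_{\mathfrak a,B}(Y)=F^{2\times2}$, $0$ if $\mathrm{End}_{\mathfrak a,B}(Y)=F'$, and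 $-1$ if $\mathrm{End}_{\mathfrak a,B}(Y)$ is a quaternion division algebra over $F$. For the $B'$-module $X_0$ the indicator is defined in the same way with $\mathrm{End}_B(\mathrm{Res}_{F'/F}X_0)$ (i.e. for the pair $(\mathfrak b,B)$). *)

(* Defs.v *)
From HB Require Import structures.
From mathcomp Require Import all_boot all_algebra all_field.
From mathcomp Require Import boolp classical_sets.
From mathcomp Require Import finmap.
From mathcomp Require Import monalg.
From mathcomp Require Import mpoly.

Set Implicit Arguments.
Unset Strict Implicit.
Unset Printing Implicit Defensive.

Import GRing.Theory.
Local Open Scope classical_set_scope.
Local Open Scope ring_scope.
Local Open Scope quotient_scope.

(* [monalg] serves for finitely supported functions [I -> V], written
   [{malg V[I]}], and [mpoly] for polynomials; they share several names. *)
Notation "{ 'mpoly' R [ n ] }" := (mpoly n R) : type_scope.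
Notation fcoef := monalg.mcoeff.
Notation fsingle := monalg.mkmalgU.
Notation fsupp := monalg.msupp.

(** * Extension and restriction of scalars along a field morphism *)

(* [K (x)_F V] is the quotient of the free [K]-module on the set [V] by the
   [K]-submodule spanned by the following elements. *)
Definition ext_relation (F K : fieldType) (phi : {rmorphism F -> K})
    (V : lmodType F) (x : {malg K[V]}) : Prop :=
  (exists v w : V, x = << v + w >> - << v >> - << w >>) \/
  (exists (a : F) (v : V), x = << a *: v >> - << phi a *g v >>).

Definition ext_null (F K : fieldType) (phi : {rmorphism F -> K})
    (V : lmodType F) : {pred {malg K[V]}} :=
  fun x => `[< exists s : seq (K * {malg K[V]}),
     (forall p, p \in s -> ext_relation phi p.2) /\
     x = \sum_(p <- s) p.1 *: p.2 >].
Arguments ext_null {F K} phi V _.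

Lemma ext_nullP (F K : fieldType) (phi : {rmorphism F -> K})
    (V : lmodType F) (x : {malg K[V]}) :
  reflect (exists s : seq (K * {malg K[V]}),
      (forall p, p \in s -> ext_relation phi p.2) /\
      x = \sum_(p <- s) p.1 *: p.2)
    (x \in ext_null phi V).
Proof. exact: asboolP. Qed.

Lemma ext_null_scale (F K : fieldType) (phi : {rmorphism F -> K})
    (V : lmodType F) (a : K) (x : {malg K[V]}) :
  x \in ext_null phi V -> a *: x \in ext_null phi V.
Proof.
move=> /ext_nullP [s [hs ->]]; apply/ext_nullP.
exists [seq (a * p.1, p.2) | p <- s]; split.
  by move=> p /mapP [q qs ->]; exact: (hs q qs).
by rewrite big_map scaler_sumr; apply: eq_bigr => p _; rewrite scalerA.
Qed.

Lemma ext_null_zmod_closed (F K : fieldType) (phi : {rmorphism F -> K})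
    (V : lmodType F) : zmod_closed (ext_null phi V).
Proof.
split; first by apply/ext_nullP; exists [::]; rewrite big_nil.
move=> x y hx /(@ext_null_scale _ _ _ _ (-1)) hy; rewrite -scaleN1r.
move: hx hy => /ext_nullP [s [hs ->]] /ext_nullP [t [ht ->]].
apply/ext_nullP; exists (s ++ t); rewrite big_cat; split=> // p.
by rewrite mem_cat => /orP [/hs|/ht].
Qed.

HB.instance Definition _ (F K : fieldType) (phi : {rmorphism F -> K})
    (V : lmodType F) :=
  GRing.isZmodClosed.Build {malg K[V]} (ext_null phi V)
    (@ext_null_zmod_closed F K phi V).

Definition ext (F K : fieldType) (phi : {rmorphism F -> K}) (V : lmodType F)
    : Type := Quotient.quot (ext_null phi V).

HB.instance Definition _ (F K : fieldType) (phi : {rmorphism F -> K})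
    (V : lmodType F) := GRing.Zmodule.on (ext phi V).

Definition ext_pi (F K : fieldType) (phi : {rmorphism F -> K})
    (V : lmodType F) (x : {malg K[V]}) : ext phi V :=
  \pi_(Quotient.quot (ext_null phi V)) x.

Definition ext_repr (F K : fieldType) (phi : {rmorphism F -> K})
    (V : lmodType F) (x : ext phi V) : {malg K[V]} :=
  repr (x : Quotient.quot (ext_null phi V)).

Definition ext_scale (F K : fieldType) (phi : {rmorphism F -> K})
    (V : lmodType F) (a : K) (x : ext phi V) : ext phi V :=
  ext_pi phi (a *: ext_repr x).

Section ExtLmodule.
Context (F K : fieldType) (phi : {rmorphism F -> K}) (V : lmodType F).

Lemma ext_reprK : cancel (@ext_repr F K phi V) (@ext_pi F K phi V).
Proof. by move=> x; rewrite /ext_pi reprK. Qed.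

Lemma ext_piD (x y : {malg K[V]}) :
  ext_pi phi (x + y) = ext_pi phi x + ext_pi phi y.
Proof. by rewrite /ext_pi raddfD. Qed.

Lemma ext_piP (x y : {malg K[V]}) :
  ext_pi phi x = ext_pi phi y <-> x - y \in ext_null phi V.
Proof. by rewrite Quotient.idealrBE; split=> [/eqP|/eqP]. Qed.

Lemma ext_scale_pi (a : K) (x : {malg K[V]}) :
  ext_scale a (ext_pi phi x) = ext_pi phi (a *: x).
Proof.
apply/ext_piP; rewrite -scalerBr; apply: ext_null_scale.
by apply/ext_piP; rewrite ext_reprK.
Qed.

Lemma ext_scaleA (a b : K) (x : ext phi V) :
  ext_scale a (ext_scale b x) = ext_scale (a * b) x.
Proof. by rewrite -(ext_reprK x) !ext_scale_pi scalerA. Qed.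

Lemma ext_scale1 : left_id 1 (@ext_scale F K phi V).
Proof. by move=> x; rewrite -(ext_reprK x) ext_scale_pi scale1r. Qed.

Lemma ext_scaleDr : right_distributive (@ext_scale F K phi V) +%R.
Proof.
move=> a x y; rewrite -(ext_reprK x) -(ext_reprK y) -ext_piD.
by rewrite !ext_scale_pi -ext_piD scalerDr.
Qed.

Lemma ext_scaleDl (x : ext phi V) : {morph (@ext_scale F K phi V)^~ x : a b / a + b}.
Proof.
by move=> a b; rewrite -(ext_reprK x) !ext_scale_pi -ext_piD scalerDl.
Qed.

HB.instance Definition _ := GRing.Zmodule_isLmodule.Build K (ext phi V)
  ext_scaleA ext_scale1 ext_scaleDr ext_scaleDl.
End ExtLmodule.

(* [1 (x) v] *)
Definition ext_in (F K : fieldType) (phi : {rmorphism F -> K})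
    (V : lmodType F) (v : V) : ext phi V := ext_pi phi (<< v >>).

(* The value at [x = sum_v c_v (x) v] of the additive map sending [c (x) v] to
   [f c v]; by [ext_lift_pi], it does not depend on the representative when [f] is
   [F]-balanced. *)
Definition ext_lift (F K : fieldType) (phi : {rmorphism F -> K})
    (V : lmodType F) (U : zmodType) (f : K -> V -> U) (x : ext phi V) : U :=
  \sum_(v <- fsupp (ext_repr x)) f (fcoef v (ext_repr x)) v.

Section ExtLift.
Context (F K : fieldType) (phi : {rmorphism F -> K}) (V : lmodType F)
  (U : zmodType) (f : K -> V -> U)
  (fl : forall v, {morph (f^~ v) : a b / a + b})
  (fr : forall c, {morph (f c) : a b / a + b})
  (fb : forall c a v, f (c * phi a) v = f c (a *: v)).

Let S (x : {malg K[V]}) := \sum_(v <- fsupp x) f (fcoef v x) v.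
Lemma ext_lift_f0 v : f 0 v = 0.
Proof. by apply: (@addrI _ (f 0 v)); rewrite -fl !addr0. Qed.

Lemma ext_lift_sumE (d : {fset V}) x : (fsupp x `<=` d)%fset ->
  S x = \sum_(v <- d) f (fcoef v x) v.
Proof.
move=> le; rewrite /S; apply: big_fset_incl => // v _ hv.
by rewrite monalg.mcoeff_outdom // ext_lift_f0.
Qed.

Lemma ext_lift_sumD x y : S (x + y) = S x + S y.
Proof.
pose d := (fsupp x `|` fsupp y)%fset.
rewrite (@ext_lift_sumE d x) ?fsubsetUl // (@ext_lift_sumE d y) ?fsubsetUr // (@ext_lift_sumE d (x+y)).
  by rewrite -big_split; apply: eq_bigr => v _; rewrite monalg.mcoeffD fl.
exact: monalg.msuppD_le.
Qed.

Lemma ext_lift_sumU c v : S (<< c *g v >>)%M = f c v.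
Proof.
rewrite (@ext_lift_sumE [fset v]%fset) ?monalg.msuppU_le // big_seq_fset1.
by rewrite monalg.mcoeffUU.
Qed.

Lemma ext_lift_sum0 : S 0 = 0. Proof. by apply: (@addrI _ (S 0)); rewrite -ext_lift_sumD !addr0. Qed.

Lemma ext_lift_sumN x : S (- x) = - S x.
Proof. by apply: (@addrI _ (S x)); rewrite -ext_lift_sumD !subrr ext_lift_sum0. Qed.

Lemma ext_lift_null x : x \in ext_null phi V -> S x = 0.
Proof.
move=> /ext_nullP [s [hs ->]].
elim: s hs => [|p s IH] hs; first by rewrite big_nil ext_lift_sum0.
rewrite big_cons ext_lift_sumD IH ?addr0; last by move=> q qs; apply: hs; rewrite inE qs orbT.
have sc c d v : S (c *: << d *g v >>)%M = f (c * d) v.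
  suff -> : (c *: << d *g v >>)%M = << c * d *g v >>%M :> {malg K[V]} by exact: ext_lift_sumU.
  by apply/monalg.malgP=> k; rewrite monalg.mcoeffZ !monalg.mcoeffU mulrnAr.
have [[v [w ->]]|[a [v ->]]] := hs p (mem_head _ _).
  by rewrite !scalerBr !ext_lift_sumD !ext_lift_sumN !sc mulr1 fr [f _ v + _]addrC addrK subrr.
by rewrite !scalerBr !ext_lift_sumD !ext_lift_sumN !sc mulr1 -fb subrr.
Qed.

Lemma ext_lift_pi x : ext_lift f (ext_pi phi x) = S x.
Proof.
apply/eqP; rewrite -subr_eq0 -ext_lift_sumN -ext_lift_sumD; apply/eqP/ext_lift_null.
by apply/ext_piP; rewrite ext_reprK.
Qed.
End ExtLift.

Definition res (F K : fieldType) (phi : {rmorphism F -> K}) (V : lmodType K)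
    : Type := V.

HB.instance Definition _ (F K : fieldType) (phi : {rmorphism F -> K})
    (V : lmodType K) := GRing.Zmodule.on (res phi V).

Definition res_scale (F K : fieldType) (phi : {rmorphism F -> K})
    (V : lmodType K) (a : F) (v : res phi V) : res phi V :=
  phi a *: (v : V).

Section ResLmodule.
Context (F K : fieldType) (phi : {rmorphism F -> K}) (V : lmodType K).

Lemma res_scaleA (a b : F) (x : res phi V) :
  res_scale a (res_scale b x) = res_scale (a * b) x.
Proof. by rewrite /res_scale scalerA rmorphM. Qed.

Lemma res_scale1 : left_id 1 (@res_scale F K phi V).
Proof. by move=> x; rewrite /res_scale rmorph1 scale1r. Qed.

Lemma res_scaleDr : right_distributive (@res_scale F K phi V) +%R.
Proof. by move=> a x y; exact: scalerDr. Qed.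

Lemma res_scaleDl (x : res phi V) : {morph (@res_scale F K phi V)^~ x : a b / a + b}.
Proof. by move=> a b; rewrite /res_scale rmorphD; exact: scalerDl. Qed.

HB.instance Definition _ := GRing.Zmodule_isLmodule.Build F (res phi V)
  res_scaleA res_scale1 res_scaleDr res_scaleDl.
End ResLmodule.

(** * Linear algebraic groups *)

(* The affine coordinates of [g] in [GL_n] are its entries and, in the last
   position, the inverse [y] of its determinant: the coordinate ring of [GL_n]
   is [F[x_ij, y] / (det x * y - 1)]. *)
Definition gl_coord (n : nat) (S : pzRingType) (g : 'M[S]_n) (y : S)
    : 'I_(n * n + 1) -> S :=
  fun k => row_mx (mxvec g) (y%:M : 'M_1) ord0 k.

Definition gl_mx (n : nat) (S : pzRingType) (c : 'I_(n * n + 1) -> S)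
    : 'M[S]_n := \matrix_(i, j) c (lshift 1 (mxvec_index i j)).

Definition gl_idet (n : nat) (S : pzRingType) (c : 'I_(n * n + 1) -> S) : S :=
  c (rshift (n * n) ord0).

Definition det_rel (F : fieldType) (n : nat) : {mpoly F[n * n + 1]} :=
  \det (gl_mx (fun k => 'X_k)) * gl_idet (fun k => 'X_k) - 1.

(* A closed subscheme of [GL_n] over [F] is given by finitely many equations;
   [points phi E] is its set of points in the [F]-algebra [phi : F -> R]. *)
Notation gl_eqs F n := (seq {mpoly F[n * n + 1]}).

Definition points (F : fieldType) (n : nat) (R : comUnitRingType)
    (phi : {rmorphism F -> R}) (E : gl_eqs F n) : set 'M[R]_n :=
  [set g | g \in unitmx /\
     forall p, p \in E -> mmap phi (gl_coord g (\det g)^-1) p = 0].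

Definition algebraic_group (F : fieldType) (n : nat) (E : gl_eqs F n) : Prop :=
  forall (R : comUnitRingType) (phi : {rmorphism F -> R}),
    [/\ points phi E 1%:M,
        forall g h, points phi E g -> points phi E h -> points phi E (g *m h)
      & forall g, points phi E g -> points phi E (invmx g)].

Definition eqs_ext (F K : fieldType) (phi : {rmorphism F -> K}) (n : nat)
    (E : gl_eqs F n) : gl_eqs K n := [seq map_mpoly phi p | p <- E].

Definition is_algebraic_closure (F : fieldType) (K : closedFieldType)
    (phi : {rmorphism F -> K}) : Prop := forall x : K, algebraicOver phi x.

(* Connectedness of a set of [K]-points for the topology whose closed sets are
   defined by polynomials over [F]. *)
Definition zariski_connected (F K : fieldType) (phi : {rmorphism F -> K})
    (n : nat) (S : set 'M[K]_n) : Prop :=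
  S !=set0 /\
  forall E1 E2 : gl_eqs F n,
    S `<=` points phi E1 `|` points phi E2 ->
    S `&` points phi E1 `&` points phi E2 = set0 ->
    S `<=` points phi E1 \/ S `<=` points phi E2.

Definition zariski_component (F K : fieldType) (phi : {rmorphism F -> K})
    (n : nat) (G C : set 'M[K]_n) : Prop :=
  [/\ C `<=` G, zariski_connected phi C
    & forall D, D `<=` G -> zariski_connected phi D -> C `<=` D -> D `<=` C].

(* The connected components of the scheme [B] over [F] are, on points in an
   algebraic closure [K], the components for the [F]-topology. *)
Definition geom_connected_components (F : fieldType) (n : nat)
    (B : gl_eqs F n) : Prop :=
  forall (K : closedFieldType) (phi : {rmorphism F -> K}),
    is_algebraic_closure phi ->
    forall C, zariski_component phi (points phi B) C ->
      zariski_connected (idfun : {rmorphism K -> K}) C.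

Definition unipotent_mx (K : fieldType) (n : nat) (g : 'M[K]_n) : Prop :=
  exists k : nat, (g - 1%:M) ^+ k = 0.

(* The unipotent radical over an algebraic closure is trivial. *)
Definition reductive (F : fieldType) (n : nat) (B : gl_eqs F n) : Prop :=
  forall (K : closedFieldType) (phi : {rmorphism F -> K}),
    is_algebraic_closure phi ->
    forall U : gl_eqs K n,
      let UK := points (idfun : {rmorphism K -> K}) U in
      algebraic_group U ->
      UK `<=` points phi B ->
      (forall g u, points phi B g -> UK u -> UK (g *m u *m invmx g)) ->
      zariski_connected (idfun : {rmorphism K -> K}) UK ->
      (forall u, UK u -> unipotent_mx u) ->
      UK = [set 1%:M].

Definition condition_Q (F : fieldType) (n : nat) (B : gl_eqs F n) : Prop :=
  exists B0 : gl_eqs F n,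
    [/\ algebraic_group B0,
        forall (R : comUnitRingType) (phi : {rmorphism F -> R}),
          points phi B0 `<=` points phi B
      & forall (K : closedFieldType) (phi : {rmorphism F -> K}),
          is_algebraic_closure phi ->
          (exists s : seq 'M[K]_n, forall g, points phi B0 g -> g \in s) /\
          forall C,
            zariski_component (idfun : {rmorphism K -> K}) (points phi B) C ->
            C `&` points phi B0 !=set0].

(* The derivative at the identity in the direction of the tangent vector [X];
   the [det^-1]-coordinate of [1 + eps X] is [1 - eps tr X]. *)
Definition deriv1 (F : fieldType) (n : nat) (X : 'M[F]_n)
    (p : {mpoly F[n * n + 1]}) : F :=
  \sum_k (mderiv k p).@[gl_coord 1%:M 1] * gl_coord X (- \tr X) k.

Definition Lie_alg (F : fieldType) (n : nat) (B : gl_eqs F n)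
    : set 'M[F]_n := [set X | forall p, p \in B -> deriv1 X p = 0].

(** * Vector-valued polynomials *)

(* [V (x)_F F[x_1, ..., x_N]], as finitely supported families of coefficients
   in [V] indexed by monomials. *)
Notation vpoly N V := {malg V['X_{1..N}]}.

Definition vmap (V W : zmodType) (N : nat) (T : V -> W) (h : vpoly N V)
    : vpoly N W := \sum_(m <- fsupp h) fsingle m (T (fcoef m h)).

Definition vmul (F : fieldType) (V : lmodType F) (N : nat) (h : vpoly N V)
    (p : {mpoly F[N]}) : vpoly N V :=
  \sum_(m <- fsupp h) \sum_(k <- msupp p)
    fsingle (m + k)%MM (p@_k *: fcoef m h).

Definition vprod (U V W : zmodType) (N : nat) (b : U -> V -> W)
    (h : vpoly N U) (k : vpoly N V) : vpoly N W :=
  \sum_(m <- fsupp h) \sum_(l <- fsupp k)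
    fsingle (m + l)%MM (b (fcoef m h) (fcoef l k)).

Definition vsubst (F : fieldType) (V : lmodType F) (N M : nat)
    (q : 'I_N -> {mpoly F[M]}) (h : vpoly N V) : vpoly M V :=
  \sum_(m <- fsupp h) vmul (fsingle 0%MM (fcoef m h)) (mmap1 q m).

Definition veval (F : fieldType) (V : lmodType F) (N : nat) (e : 'I_N -> F)
    (h : vpoly N V) : V := \sum_(m <- fsupp h) mmap1 e m *: fcoef m h.

(* [h] vanishes in [V (x) F[x_1, ..., x_N] / (I)]. *)
Definition vnull (F : fieldType) (V : lmodType F) (N : nat)
    (I : seq {mpoly F[N]}) (h : vpoly N V) : Prop :=
  exists c : 'I_(size I) -> vpoly N V, h = \sum_i vmul (c i) I`_i.

Definition vderiv1 (F : fieldType) (V : lmodType F) (n : nat) (X : 'M[F]_n)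
    (h : vpoly (n * n + 1) V) : V :=
  \sum_(m <- fsupp h) deriv1 X 'X_[m] *: fcoef m h.

(** * Rational modules *)

(* Generators of the ideal of [B], so that [F[B] = F[x_ij, y] / (B_ideal B)],
   and of the ideal of [B x B] in two sets of variables. *)
Definition B_ideal (F : fieldType) (n : nat) (B : gl_eqs F n)
    : seq {mpoly F[n * n + 1]} := det_rel F n :: B.

Definition left_var (F : fieldType) (N : nat) (k : 'I_N) : {mpoly F[N + N]} :=
  'X_(lshift N k).

Definition right_var (F : fieldType) (N : nat) (k : 'I_N) : {mpoly F[N + N]} :=
  'X_(rshift N k).

Definition BB_ideal (F : fieldType) (n : nat) (B : gl_eqs F n)
    : seq {mpoly F[(n * n + 1) + (n * n + 1)]} :=
  [seq p \mPo [tuple left_var F k | k < n * n + 1] | p <- B_ideal B] ++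
  [seq p \mPo [tuple right_var F k | k < n * n + 1] | p <- B_ideal B].

(* The coordinates of the product [g *m h]. *)
Definition comult (F : fieldType) (n : nat)
    : 'I_(n * n + 1) -> {mpoly F[(n * n + 1) + (n * n + 1)]} :=
  gl_coord (gl_mx (@left_var F (n * n + 1)) *m gl_mx (@right_var F (n * n + 1)))
    (gl_idet (@left_var F (n * n + 1)) * gl_idet (@right_var F (n * n + 1))).

(* A rational [B]-module is a comodule [V -> V (x) F[B]]; [coact] is a linear
   lift of the coaction to [V (x) F[x_ij, y]], with [g v = coact v (g)]. *)
Record coaction (F : fieldType) (n : nat) := Coaction {
  carrier :> lmodType F;
  coact : carrier -> vpoly (n * n + 1) carrier
}.

(* Such a comodule is automatically locally finite. *)
Definition rational_module (F : fieldType) (n : nat) (B : gl_eqs F n)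
    (V : coaction F n) : Prop :=
  [/\ forall (a : F) (v w : V) m, fcoef m (coact (a *: v + w)) =
        a *: fcoef m (coact v) + fcoef m (coact w),
      forall v : V, veval (gl_coord 1%:M 1) (coact v) = v
    & forall v : V, vnull (BB_ideal B)
        (vsubst (@comult F n) (coact v) -
         \sum_(m <- fsupp (coact v))
           vmul (vsubst (@left_var F (n * n + 1)) (coact (fcoef m (coact v))))
             (mmap1 (@right_var F (n * n + 1)) m))].

Definition coaction_ext (F K : fieldType) (phi : {rmorphism F -> K}) (n : nat)
    (V : coaction F n) : coaction K n :=
  @Coaction K n (ext phi V)
    (ext_lift (fun c v => vmap (fun u : V => c *: ext_in phi u) (coact v))).

(* [V (x)_K K[x_ij, y]] and [V (x)_F F[x_ij, y]] are the same set of families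
   of coefficients in [V]. *)
Definition coaction_res (F K : fieldType) (phi : {rmorphism F -> K}) (n : nat)
    (V : coaction K n) : coaction F n :=
  @Coaction F n (res phi V) (@coact K n V).

Definition subspace (F : fieldType) (V : lmodType F) (U : set V) : Prop :=
  U 0 /\ forall (a : F) v w, U v -> U w -> U (a *: v + w).

(* The coaction of [U] takes values in [U (x) F[B]]. *)
Definition B_stable (F : fieldType) (n : nat) (B : gl_eqs F n)
    (V : coaction F n) (U : set V) : Prop :=
  forall u, U u -> exists h : vpoly (n * n + 1) V,
    (forall m, U (fcoef m h)) /\ vnull (B_ideal B) (coact u - h).

Definition B_irreducible (F : fieldType) (n : nat) (B : gl_eqs F n)
    (V : coaction F n) : Prop :=
  (exists v : V, v <> 0) /\
  forall U : set V, subspace U -> B_stable B U -> U = [set 0] \/ U = setT.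

Definition B_absolutely_irreducible (F : fieldType) (n : nat) (B : gl_eqs F n)
    (V : coaction F n) : Prop :=
  forall (K : fieldType) (phi : {rmorphism F -> K}),
    B_irreducible (eqs_ext phi B) (coaction_ext phi V).

Definition linear_map (F : fieldType) (V W : lmodType F) (T : V -> W) : Prop :=
  forall (a : F) v w, T (a *: v + w) = a *: T v + T w.

Definition B_hom (F : fieldType) (n : nat) (B : gl_eqs F n)
    (V W : coaction F n) : set (V -> W) :=
  [set T | linear_map T /\
     forall v, vnull (B_ideal B) (vmap T (coact v) - coact (T v))].

(* [dim Hom_B(V, W) = 1] *)
Definition multiplicity_one (F : fieldType) (n : nat) (B : gl_eqs F n)
    (V W : coaction F n) : Prop :=
  exists T : V -> W,
    [/\ B_hom B T, exists v, T v <> 0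
      & forall T', B_hom B T' -> exists c : F, forall v, T' v = c *: T v].

(** * Pairs and their modules *)

(* The Lie algebra [a] carries the coaction of [B]; only the values of [emb] on
   the subspace [Lie B] of ['M_n] are relevant. *)
Record pair (F : fieldType) := Pair {
  dim_B : nat;
  grp : gl_eqs F dim_B;
  lie : coaction F dim_B;
  bracket : lie -> lie -> lie;
  emb : 'M[F]_dim_B -> lie
}.
Arguments emb {F} p _.

Definition finite_dim (F : fieldType) (V : lmodType F) : Prop :=
  exists (d : nat) (e : 'I_d -> V),
    forall v, exists c : 'I_d -> F, v = \sum_i c i *: e i.

Definition bilinear_map (F : fieldType) (U V W : lmodType F)
    (b : U -> V -> W) : Prop :=
  (forall u, linear_map (b u)) /\ (forall v, linear_map (b ^~ v)).

Definition lie_bracket (F : fieldType) (L : lmodType F) (b : L -> L -> L)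
    : Prop :=
  [/\ bilinear_map b, forall x, b x x = 0
    & forall x y z, b x (b y z) + b y (b z x) + b z (b x y) = 0].

Definition is_pair (F : fieldType) (P : pair F) : Prop :=
  [/\ [/\ algebraic_group (grp P), reductive (grp P)
        & geom_connected_components (grp P)],
      finite_dim (lie P) /\ lie_bracket (@bracket F P),
      [/\ linear_map (emb P),
          forall X, Lie_alg (grp P) X -> emb P X = 0 -> X = 0
        & forall X Y, Lie_alg (grp P) X -> Lie_alg (grp P) Y ->
            emb P (X *m Y - Y *m X) = bracket (emb P X) (emb P Y)],
      rational_module (grp P) (lie P) /\
      (forall x y : lie P, vnull (B_ideal (grp P))
         (vprod (@bracket F P) (coact x) (coact y) - coact (bracket x y)))
    & forall X, Lie_alg (grp P) X -> forall y : lie P,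
        vderiv1 X (coact y) = bracket (emb P X) y].

Definition pair_ext (F K : fieldType) (phi : {rmorphism F -> K}) (P : pair F)
    : pair K :=
  @Pair K (dim_B P) (eqs_ext phi (grp P)) (coaction_ext phi (lie P))
    (fun x y => ext_lift (fun c u =>
       ext_lift (fun d v => (c * d) *: ext_in phi (bracket u v)) y) x)
    (fun X => \sum_i \sum_j X i j *: ext_in phi (emb P (delta_mx i j))).

Record abmodule (F : fieldType) (P : pair F) := ABModule {
  ab_coaction :> coaction F (dim_B P);
  ab_act : lie P -> ab_coaction -> ab_coaction
}.

Definition is_abmodule (F : fieldType) (P : pair F) (X : abmodule P) : Prop :=
  [/\ rational_module (grp P) X,
      bilinear_map (@ab_act F P X),
      forall (x y : lie P) (v : X), ab_act (bracket x y) v =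
        ab_act x (ab_act y v) - ab_act y (ab_act x v),
      forall (x : lie P) (v : X), vnull (B_ideal (grp P))
        (vprod (@ab_act F P X) (coact x) (coact v) - coact (ab_act x v))
    & forall Z, Lie_alg (grp P) Z -> forall v : X,
        ab_act (emb P Z) v = vderiv1 Z (coact v)].

Definition ab_ext (F K : fieldType) (phi : {rmorphism F -> K}) (P : pair F)
    (X : abmodule P) : abmodule (pair_ext phi P) :=
  @ABModule K (pair_ext phi P) (coaction_ext phi X)
    (fun x v => ext_lift (fun c y =>
       ext_lift (fun d w => (c * d) *: ext_in phi (ab_act y w)) v) x).

Definition ab_res (F K : fieldType) (phi : {rmorphism F -> K}) (P : pair F)
    (X : abmodule (pair_ext phi P)) : abmodule P :=
  @ABModule F P (coaction_res phi X)
    (fun x v => @ab_act K (pair_ext phi P) X (ext_in phi x) v).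

Definition ab_irreducible (F : fieldType) (P : pair F) (X : abmodule P)
    : Prop :=
  (exists v : X, v <> 0) /\
  forall U : set X, subspace U -> B_stable (grp P) U ->
    (forall x v, U v -> U (ab_act x v)) -> U = [set 0] \/ U = setT.

Definition ab_absolutely_irreducible (F : fieldType) (P : pair F)
    (X : abmodule P) : Prop :=
  forall (K : fieldType) (phi : {rmorphism F -> K}),
    ab_irreducible (ab_ext phi X).

Definition ab_end (F : fieldType) (P : pair F) (X : abmodule P)
    : set (X -> X) :=
  [set T | B_hom (grp P) T /\ forall x v, T (ab_act x v) = ab_act x (T v)].

(** * The Frobenius-Schur indicator *)

(* The set [S] of endomorphisms of [V] is an [F]-algebra isomorphic to [A]. *)
Definition isomorphic_algebra (F : fieldType) (V : lmodType F)
    (S : set (V -> V)) (A : algType F) : Prop :=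
  exists f : A -> V -> V,
    [/\ range f = S, injective f,
        forall (c : F) x y v, f (c *: x + y) v = c *: f x v + f y v,
        forall v, f 1 v = v
      & forall x y v, f (x * y) v = f x (f y v)].

(* Quaternion algebras are the central simple algebras of dimension 4. *)
Definition quaternion_division_algebra (F : fieldType) (D : falgType F)
    : Prop :=
  [/\ \dim {:D} = 4%N,
      forall x : D, (forall y, x * y = y * x) -> exists c : F, x = c%:A
    & forall x : D, x != 0 -> x \is a GRing.unit].

Definition FS_values (F : fieldType) (F' : fieldExtType F) (V : lmodType F)
    (S : set (V -> V)) (e : int) : Prop :=
  [\/ e = 1 /\ isomorphic_algebra S 'M[F]_2,
      e = 0 /\ isomorphic_algebra S F'
    | e = -1 /\ exists D : falgType F,
        quaternion_division_algebra D /\ isomorphic_algebra S D].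

(* The value [0] is also the default when none of the cases applies, so that a
   nonzero indicator is always one of the genuine cases [1] and [-1]. *)
Definition FS (F : fieldType) (F' : fieldExtType F) (V : lmodType F)
    (S : set (V -> V)) : int := xget 0 [set e | FS_values F' S e].

Definition FS_ab (F : fieldType) (F' : fieldExtType F) (P : pair F)
    (X : abmodule (pair_ext (in_alg F') P)) : int :=
  FS F' (ab_end (X := ab_res X)).

Definition FS_B (F : fieldType) (F' : fieldExtType F) (n : nat)
    (B : gl_eqs F n) (X0 : coaction F' n) : int :=
  let Y0 := coaction_res (in_alg F') X0 in FS F' (B_hom B (V := Y0) (W := Y0)).

(* Main.v *)
Require Import Defs.
From HB Require Import structures.
From mathcomp Require Import all_boot all_algebra all_field.
From mathcomp Require Import boolp classical_sets finmap.
From mathcomp Require Import ring.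
From mathcomp Require Import monalg.
From mathcomp Require Import mpoly.

Set Implicit Arguments.
Unset Strict Implicit.
Unset Printing Implicit Defensive.

Import GRing.Theory.
Local Open Scope ring_scope.

(** Write [F' = F(i)] with [i * i = d], [d] not a square in [F]. The
    endomorphism algebras [E] of [Res X] and [E0] of [Res X0] both contain the
    scaling by [i], and each contains a nonzero map anticommuting with it, that
    is, conjugate-linear over [F'].  An indicator [1] yields such a map with
    square [1] ([split_anticommuting_involution]).  An indicator [-1] yields such a
    map [J] for which [J * J] is never a norm [a^2 - d b^2] from [F'] to [F]
    ([division_anticommuting]): otherwise multiplying [J] by [a + b i] would
    produce an anticommuting element whose square is the square of a scalar,
    and in a division algebra this element would itself be a scalar, which
    cannot anticommute with [i].

    The multiplicity-one hypothesis links the two algebras.  Let [T : X0 -> X]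
    span the [B']-homomorphisms, and take conjugate-linear [J] in [E] and [J0]
    in [E0].  Then [J T J0] is again [F']-linear and [B']-equivariant, hence
    equals [c T] for some [c = a + b i], and applying [J] and [J0] once more
    gives [J^2 T J0^2 = (a^2 - d b^2) T] ([intertwiner_norm]).  If the two
    indicators were different, one of [J], [J0] could be taken to be an
    involution and the other one to have a square that is not a norm.  As the
    difference of that square and the norm is then a bijection killed on one
    side of [T], the map [T] would vanish.

    Equivariance is expressed through coactions modulo the ideal of [B].  The
    composite [J T J0] is treated over [F], where all three maps are linear;
    [B_hom_res] goes back and forth between [F] and [F'], because the ideal of
    [B'] is generated by polynomials over [F]. *)

(** * Linear maps and vector-valued polynomials *)

Lemma vmapE (V W : zmodType) (N : nat) (T : V -> W) (h : vpoly N V) m :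
  T 0 = 0 -> fcoef m (vmap T h) = T (fcoef m h).
Proof.
move=> T0; rewrite /vmap raddf_sum /=.
under eq_bigr do rewrite monalg.mcoeffU.
have [hm | hm] := boolP (m \in fsupp h).
  rewrite (big_fsetD1 m) //= eqxx mulr1n big_seq big1 ?addr0 // => k.
  by rewrite in_fsetD1 => /andP[/negPf-> _].
rewrite (monalg.mcoeff_outdom hm) T0 big_seq big1 // => k hk.
by case: eqP => // e; rewrite -e hk in hm.
Qed.

Lemma fsupp_vmap (V W : zmodType) (N : nat) (T : V -> W) (h : vpoly N V) :
  T 0 = 0 -> (fsupp (vmap T h) `<=` fsupp h)%fset.
Proof.
move=> T0; apply/fsubsetP => m; apply: contraTT => hm.
by rewrite -monalg.mcoeff_eq0 vmapE // (monalg.mcoeff_outdom hm) T0.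
Qed.

(** Enlarging the range of summation to a common one makes [vmul] visibly
    additive, although its support varies with the argument. *)
Lemma vmulEw (F : fieldType) (V : lmodType F) (N : nat) (d : {fset _})
    (h : vpoly N V) p : (fsupp h `<=` d)%fset ->
  vmul h p = \sum_(m <- d) \sum_(k <- mpoly.msupp p)
    fsingle (m + k)%MM (mpoly.mcoeff k p *: fcoef m h).
Proof.
move=> le; apply: big_fset_incl => // m _ hm.
rewrite big1 // => k _.
by rewrite (monalg.mcoeff_outdom hm) scaler0 monalg.monalgU0.
Qed.

Lemma vmulD (F : fieldType) (V : lmodType F) (N : nat) (h k : vpoly N V) p :
  vmul (h + k) p = vmul h p + vmul k p.
Proof.
pose d := (fsupp h `|` fsupp k)%fset.
rewrite (@vmulEw _ _ _ d h) ?fsubsetUl // (@vmulEw _ _ _ d k) ?fsubsetUr //.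
rewrite (@vmulEw _ _ _ d (h + k)) ?monalg.msuppD_le // -big_split.
apply: eq_bigr => m _; rewrite -big_split; apply: eq_bigr => l _ /=.
by rewrite monalg.mcoeffD scalerDr monalg.monalgUD.
Qed.

Lemma vmul0 (F : fieldType) (V : lmodType F) (N : nat) p :
  vmul (0 : vpoly N V) p = 0.
Proof. by apply: (@addrI _ (vmul 0 p)); rewrite -vmulD !addr0. Qed.

Lemma vmap_fsingle (V W : zmodType) (N : nat) (T : V -> W)
    (m : mpoly.multinom N) v :
  T 0 = 0 -> vmap T (fsingle m v : vpoly N V) = fsingle m (T v).
Proof.
move=> T0; apply/monalg.malgP => k; rewrite vmapE // !monalg.mcoeffU.
by case: (m == k); rewrite ?mulr1n ?mulr0n ?T0.
Qed.

Lemma vmap_sum (V W : zmodType) (N : nat) (T : V -> W)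
    (TD : {morph T : x y / x + y}) (T0 : T 0 = 0)
    (I : Type) (r : seq I) (h : I -> vpoly N V) :
  vmap T (\sum_(i <- r) h i) = \sum_(i <- r) vmap T (h i).
Proof.
apply/monalg.malgP => m; rewrite vmapE // !raddf_sum /= (big_morph T TD T0).
by apply: eq_bigr => i _; rewrite vmapE.
Qed.

Lemma linear_map0 (F : fieldType) (V W : lmodType F) (T : V -> W) :
  linear_map T -> T 0 = 0.
Proof.
move=> lT; apply: (@addrI _ (T 0)).
by rewrite -[X in X + _]scale1r -lT scaler0 !addr0.
Qed.

Lemma linear_mapD (F : fieldType) (V W : lmodType F) (T : V -> W) :
  linear_map T -> {morph T : x y / x + y}.
Proof. by move=> lT x y; rewrite -[x in LHS]scale1r lT scale1r. Qed.

Lemma linear_mapZ (F : fieldType) (V W : lmodType F) (T : V -> W) :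
  linear_map T -> forall a v, T (a *: v) = a *: T v.
Proof.
by move=> lT a v; rewrite -[in LHS](addr0 (a *: v)) lT linear_map0 ?addr0.
Qed.

Lemma linear_mapB (F : fieldType) (V W : lmodType F) (T : V -> W) :
  linear_map T -> {morph T : x y / x - y}.
Proof. by move=> lT x y; rewrite -scaleN1r addrC lT scaleN1r addrC. Qed.

Lemma vmap_vmul (F : fieldType) (V W : lmodType F) (N : nat) (T : V -> W)
    (h : vpoly N V) p :
  linear_map T -> vmap T (vmul h p) = vmul (vmap T h) p.
Proof.
move=> lT; have T0 := linear_map0 lT; have TD := linear_mapD lT.
rewrite [RHS](vmulEw p (fsupp_vmap h T0)) {1}/vmul (vmap_sum TD T0).
apply: eq_bigr => m _; rewrite (vmap_sum TD T0); apply: eq_bigr => k _.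
by rewrite (vmap_fsingle _ _ T0) (linear_mapZ lT) (vmapE _ _ T0).
Qed.

Lemma vnullD (F : fieldType) (V : lmodType F) (N : nat) I (h k : vpoly N V) :
  vnull I h -> vnull I k -> vnull I (h + k).
Proof.
move=> [c ->] [d ->]; exists (fun i => c i + d i).
by rewrite -big_split; apply: eq_bigr => i _; rewrite vmulD.
Qed.

Lemma vnull0 (F : fieldType) (V : lmodType F) (N : nat) I :
  vnull I (0 : vpoly N V).
Proof. by exists (fun=> 0); rewrite big1 // => i _; rewrite vmul0. Qed.

Lemma vnull_vmap (F : fieldType) (V W : lmodType F) (N : nat) (T : V -> W) I
    (h : vpoly N V) : linear_map T -> vnull I h -> vnull I (vmap T h).
Proof.
move=> lT [c ->]; exists (fun i => vmap T (c i)).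
rewrite vmap_sum; [|exact: linear_mapD|exact: linear_map0].
by apply: eq_bigr => i _; rewrite vmap_vmul.
Qed.

(** * Equivariant maps *)

Lemma B_hom_comp (F : fieldType) (n : nat) (B : gl_eqs F n)
    (U V W : coaction F n) (S : V -> W) (T : U -> V) :
  B_hom B S -> B_hom B T -> B_hom B (S \o T).
Proof.
move=> [lS hS] [lT hT]; split=> [a v w | v] /=; first by rewrite lT lS.
have S0 := linear_map0 lS; have T0 := linear_map0 lT.
have -> : vmap (S \o T) (coact v) - coact (S (T v)) =
    vmap S (vmap T (coact v) - coact (T v)) +
    (vmap S (coact (T v)) - coact (S (T v))).
  have ST0 : (S \o T) 0 = 0 by rewrite /= T0.
  apply/monalg.malgP => m.
  rewrite monalg.mcoeffB [RHS]monalg.mcoeffD !monalg.mcoeffB.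
  rewrite [X in X - _ = _](vmapE _ m ST0).
  rewrite [X in _ = X + _](vmapE _ m S0) [X in _ = _ + (X - _)](vmapE _ m S0).
  rewrite monalg.mcoeffB (vmapE (coact v) m T0).
  by rewrite (linear_mapB lS) addrA subrK.
by apply: vnullD (hS _); exact: vnull_vmap lS (hT _).
Qed.

(** * Equivariance and restriction of scalars *)

Section Restriction.
Context (F K : fieldType) (phi : {rmorphism F -> K}).

Lemma B_ideal_ext n (B : gl_eqs F n) :
  B_ideal (eqs_ext phi B) = eqs_ext phi (B_ideal B).
Proof.
rewrite /B_ideal /eqs_ext /=; congr cons.
pose f : {rmorphism mpoly.mpoly (n * n + 1) F -> mpoly.mpoly (n * n + 1) K} :=
  mpoly.map_mpoly phi.
have fX : (fun k : 'I_(n * n + 1) => f 'X_k) = (fun k => 'X_k).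
  by apply/funext => k; exact: mpoly.map_mpolyX.
have detX : map_mx f (gl_mx (fun k => 'X_k)) = gl_mx (fun k => f 'X_k).
  by apply/matrixP => i j; rewrite !mxE.
rewrite -[RHS]/(f (_ - _)) rmorphB rmorph1 rmorphM -det_map_mx detX.
by rewrite -[f (gl_idet _)]/(gl_idet (fun k => f 'X_k)) fX.
Qed.

Lemma vmul_res (V : lmodType K) N (h : vpoly N V) (p : mpoly.mpoly N F) :
  vmul h (mpoly.map_mpoly phi p) = vmul (h : vpoly N (res phi V)) p.
Proof.
apply: eq_bigr => m _.
rewrite (perm_big _ (mpoly.msupp_map_mpoly _ (fmorph_inj phi))) /=.
by apply: eq_bigr => k _; rewrite mpoly.mcoeff_map_mpoly.
Qed.

(** The cofactors in [vnull] are arbitrary families of vectors, so the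
    [K]-submodule and the [F]-submodule generated by equations over [F] are the
    same set. *)
Lemma vnull_res (V : lmodType K) N I (h : vpoly N V) :
  vnull [seq mpoly.map_mpoly phi p | p <- I] h <->
  vnull I (h : vpoly N (res phi V)).
Proof.
have e := esym (size_map (mpoly.map_mpoly (n:=N) phi) I).
have bij : bijective (cast_ord e).
  by exists (cast_ord (esym e)) => i; rewrite (cast_ordK, cast_ordKV).
split=> -[c ->].
  exists (c \o cast_ord e); rewrite (reindex (cast_ord e) (onW_bij _ bij)) /=.
  apply: eq_bigr => i _; rewrite (nth_map 0 _ _ (ltn_ord i)).
  exact: vmul_res.
exists (c \o cast_ord (esym e)).
rewrite [RHS](reindex (cast_ord e) (onW_bij _ bij)) /=.
apply: eq_bigr => i _; rewrite (nth_map 0 _ _ (ltn_ord i)) /= cast_ordK.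
exact/esym/vmul_res.
Qed.

(** This permits composing [K]-linear and semilinear equivariant maps: over [F]
    all of them are linear, and [K]-linearity of the composite is a separate
    question. *)
Lemma B_hom_res n (B : gl_eqs F n) (V W : coaction K n) (T : V -> W) :
  B_hom (eqs_ext phi B) T <->
  linear_map T /\
  B_hom B (T : coaction_res phi V -> coaction_res phi W).
Proof.
split=> [[lT hT] | [lT [_ hT]]].
  split=> //; split=> [a v w | v]; first exact: lT.
  by have := hT v; rewrite B_ideal_ext => /vnull_res.
by split=> // v; rewrite B_ideal_ext; apply/vnull_res/hT.
Qed.

Lemma B_hom_scale n (B : gl_eqs F n) (B' : gl_eqs K n) (V : coaction K n)
    (c : K) :
  rational_module B' V ->
  B_hom B ((fun v => c *: v) : coaction_res phi V -> coaction_res phi V).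
Proof.
move=> [lV _ _]; split=> [a v w | v].
  by rewrite scalerDr; congr (_ + _); rewrite [LHS]scalerA mulrC -scalerA.
suff -> : vmap ( *:%R c) (coact v) = coact (c *: v).
  by rewrite subrr; exact: vnull0.
apply/monalg.malgP => m; rewrite (vmapE _ _ (scaler0 _ c)).
have l0 : fcoef m (coact (0 : V)) = 0.
  have := lV 1 0 0 m; rewrite !scale1r addr0 => /eqP.
  by rewrite -subr_eq0 opprD addrA subrr sub0r oppr_eq0 => /eqP.
by have := lV c v 0 m; rewrite addr0 l0 addr0.
Qed.

End Restriction.

(** * Anticommuting elements in quaternion algebras *)

(** Completing the square in the quadratic equation of any [x] outside [F];
    the root of a square [d] would put [x] back into [F]. *)
Lemma quadratic_generator (F : fieldType) (F' : fieldExtType F) :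
  (2%:R : F) != 0 -> \dim {:F'} = 2%N ->
  exists (i : F') (d : F),
    [/\ i * i = d%:A, forall e : F, e * e <> d
      & forall c : F', exists a b : F, c = a%:A + b *: i].
Proof.
move=> two_neq0 dimF'.
have [x x_notin] : exists x : F', x \notin 1%VS.
  apply: contrapT => /forallNP all_in.
  have /dimvS : (fullv <= (1 : {vspace F'}))%VS.
    by apply/subvP => x _; apply: contrapT => /negP /all_in.
  by rewrite dimF' dimv1.
have full : (1 + <[x]>)%VS = {:F'}%VS.
  apply/eqP; rewrite eqEdim subvf dimF' /=.
  rewrite dimv_disjoint_sum; last first.
    apply/eqP; rewrite -subv0; apply/subvP => y.
    rewrite memv_cap memv0 => /andP[/vlineP[a ->] /vlineP[b ab]].
    have [b0 | b0] := eqVneq b 0; first by rewrite ab b0 scale0r.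
    case/negP: x_notin; apply/vlineP; exists (b^-1 * a).
    by rewrite -scalerA ab scalerA mulVf // scale1r.
  by rewrite dimv1 dim_vline; case: eqP x_notin => // ->; rewrite mem0v.
have decomp (c : F') : exists a b : F, c = a%:A + b *: x.
  have : c \in (1 + <[x]>)%VS by rewrite full memvf.
  by case/memv_addP => _ /vlineP[a ->] [_ /vlineP[b ->] ->]; exists a, b.
have [p [q xx]] := decomp (x * x).
pose h := q / 2%:R; have hh : h + h = q.
  by rewrite -mulr2n -mulr_natr mulfVK.
exists (x - h%:A), (p + h * h).
have sq : (x - h%:A) * (x - h%:A) = (p + h * h)%:A.
  have toM (a : F) (y : F') : a *: y = a%:A * y by rewrite mulr_algl.
  have -> : (p + h * h)%:A = p%:A + h%:A * h%:A :> F'.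
    by rewrite -toM scalerA scalerDl.
  transitivity (x * x - (h%:A + h%:A) * x + h%:A * h%:A); first by ring.
  by rewrite xx -hh toM scalerDl; ring.
split=> // [e ee | c].
  have : (x - h%:A - e%:A) * (x - h%:A + e%:A) == 0.
    by rewrite -subr_sqr !expr2 sq -ee mulr_algl scalerA subrr.
  rewrite mulf_eq0 subr_eq0 addr_eq0 => /orP[] /eqP /(canRL (subrK _)) xE;
    case/negP: x_notin; rewrite xE -?scaleNr -scalerDl; exact: memvZ (mem1v _).
have [a [b ->]] := decomp c; exists (a + b * h), b.
by rewrite scalerBr scalerA scalerDl addrACA addrN addr0.
Qed.

(** Since [d] is not a square, [i] has trace zero and its lower left entry [c]
    is invertible.  A matrix [1, t; 0, -1] is always an involution, and it
    anticommutes with [i] exactly when [t c = - 2 a], with [a] the upper left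
    entry of [i]. *)
Lemma matrix_anticommuting_involution (F : fieldType) (i : 'M[F]_2) (d : F) :
  (2%:R : F) != 0 -> i * i = d%:A -> (forall e : F, e * e <> d) ->
  exists s : 'M[F]_2, s * s = 1 /\ i * s = - (s * i).
Proof.
move=> two_neq0 ii nsq.
pose a := i 0 0; pose b := i 0 1; pose c := i 1 0; pose e := i 1 1.
have ent (M N : 'M[F]_2) k l : (M * N) k l = M k 0 * N 0 l + M k 1 * N 1 l.
  by rewrite mxE !big_ord_recl big_ord0 addr0 /=; congr (_ + M _ _ * N _ _);
    apply: val_inj.
have E00 : a * a + b * c = d.
  by rewrite -ent ii !mxE /= mulr1.
have E10 : c * a + e * c = 0.
  by rewrite -ent ii !mxE /= mulr0.
have c0 : c != 0.
  by apply/eqP => c0; apply: (nsq a); rewrite -E00 c0 mulr0 addr0.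
have eE : e = - a.
  apply/eqP; rewrite -addr_eq0; apply/eqP/(mulIf c0).
  by rewrite mulrDl mul0r -E10 addrC [a * c]mulrC.
pose t := - (2%:R * a / c).
have tc : t * c = - (2%:R * a) by rewrite /t mulNr divfK.
pose s : 'M[F]_2 := \matrix_(k, l)
  if (k == 0) then (if l == 0 then 1 else t) else (if l == 0 then 0 else -1).
have ord2 (k : 'I_2) : k = 0 \/ k = 1.
  by case: k => [[|[|//]] ?]; [left|right]; apply: val_inj.
exists s; split; apply/matrixP => k l; rewrite ?[RHS]mxE !ent !mxE /=;
  case: (ord2 k) => ->; case: (ord2 l) => -> /=;
  rewrite -?/a -?/b -?/c -?/e ?eE ?[c * t]mulrC ?tc; ring.
Qed.

(** Commutators [i x - x i] anticommute with [i] because [i * i] is central;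
    one of them is nonzero because [i] is not in the centre [F]. *)
Lemma quaternion_anticommuting (F : fieldType) (D : falgType F) (i : D)
    (d : F) :
  quaternion_division_algebra D -> i * i = d%:A -> (forall e : F, e * e <> d) ->
  exists j : D, j != 0 /\ i * j = - (j * i).
Proof.
move=> [_ centre _] ii nsq.
have [x ix] : exists x : D, i * x <> x * i.
  apply: contrapT => /forallNP all_comm.
  have [y|e iE] := centre i; first exact: contrapT (all_comm y).
  apply: (nsq e); move: ii; rewrite iE mulr_algl scalerA.
  by move/(fmorph_inj (in_alg D)).
exists (i * x - x * i); split; first by rewrite subr_eq0; apply/eqP.
rewrite mulrBr mulrBl !mulrA ii mulr_algl -mulrA -[x * i * i]mulrA ii mulr_algr.
by rewrite opprB mulrA.
Qed.

(** Conjugation by [j] exchanges [a + b i] and [a - b i], so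
    [w = (a + b i) j] satisfies [w * w = N * (j * j)] with
    [N = a^2 - d b^2].  If [j * j = N], then [w = N] or [w = - N] in the absence
    of zero divisors; but [w] anticommutes with [i], and no nonzero scalar
    does. *)
Lemma anticommuting_sq_not_norm (F : fieldType) (D : falgType F) (i j : D)
    (d a b : F) :
  (2%:R : F) != 0 -> (forall x : D, x != 0 -> x \is a GRing.unit) ->
  i * i = d%:A -> i != 0 -> j != 0 -> i * j = - (j * i) ->
  j * j <> (a * a - d * (b * b))%:A.
Proof.
move=> two_neq0 Dunit ii i_neq0 j_neq0 ij jj.
set N := a * a - d * (b * b) in jj.
have nodiv (x y : D) : x * y = 0 -> x = 0 \/ y = 0.
  move=> xy; have [->|/Dunit ux] := eqVneq x 0; [by left | right].
  by rewrite -[y](mulKr ux) xy mulr0.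
have N_neq0 : N != 0.
  apply: contra_neqN j_neq0 => /eqP N0.
  by move: jj; rewrite N0 scale0r => /nodiv [].
pose w := (a%:A + b *: i) * j.
have ji : j * (a%:A + b *: i) = (a%:A - b *: i) * j.
  rewrite mulrDr mulrBl mulr_algl mulr_algr -scalerAr -scalerAl ij scalerN.
  by rewrite opprK.
have UU : (a%:A + b *: i) * (a%:A - b *: i) = N%:A.
  rewrite mulrDl !mulrBr !mulr_algl -!scalerAl -!scalerAr ii mulr1.
  by rewrite !scalerA addrA [b * a]mulrC subrK -scalerBl [b * b * d]mulrC.
have ww : w * w = (N * N)%:A.
  rewrite /w mulrA -[_ * j * _]mulrA ji mulrA UU -mulrA jj.
  by rewrite mulr_algl scalerA.
have iU : i * (a%:A + b *: i) = (a%:A + b *: i) * i.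
  by rewrite mulrDr mulrDl mulr_algl mulr_algr -scalerAr -scalerAl.
have iw : i * w = - (w * i) by rewrite /w mulrA iU -!mulrA ij mulrN.
have scalar_anti (c : F) : w = c%:A -> c = 0.
  move=> wE; apply/eqP; move: iw; rewrite wE mulr_algr mulr_algl => /eqP.
  rewrite -addr_eq0 -scalerDl scaler_eq0 (negPf i_neq0) orbF.
  by rewrite -mulr2n -mulr_natr mulf_eq0 (negPf two_neq0) orbF.
have : (w - N%:A) * (w + N%:A) = 0.
  rewrite mulrBl !mulrDr ww !mulr_algl mulr_algr scalerA.
  by rewrite [X in X - _]addrC subrr.
move=> /nodiv [/eqP | /eqP].
  by rewrite subr_eq0 => /eqP /scalar_anti /eqP; rewrite (negPf N_neq0).
rewrite addr_eq0 -scaleNr => /eqP /scalar_anti /eqP.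
by rewrite oppr_eq0 (negPf N_neq0).
Qed.

(** * Conjugate-linear endomorphisms *)

(** Transports relations between elements of [A] to the maps that they
    represent; injectivity brings the relation [I (I v) = d *: v] back to
    [A]. *)
Lemma isomorphic_algebra_lift (F : fieldType) (V : lmodType F)
    (S : set (V -> V)) (A : algType F) (I : V -> V) (d : F) :
  isomorphic_algebra S A -> S I -> (forall v, I (I v) = d *: v) ->
  exists (f : A -> V -> V) (i : A),
    [/\ forall x, S (f x), forall x y v, f (x * y) v = f x (f y v),
        forall c v, f c%:A v = c *: v,
        forall x y v, f (x - y) v = f x v - f y v & f i = I] /\ i * i = d%:A.
Proof.
move=> [f [fS finj flin f1 fM]]; rewrite -{1}fS => -[i _ fi] II.
have f0 v : f 0 v = 0.
  apply: (@addrI _ (f 0 v)).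
  by rewrite -[X in X + _]scale1r -flin scaler0 !addr0.
have fZ c v : f c%:A v = c *: v by rewrite -[c%:A]addr0 flin f1 f0 addr0.
exists f, i; split; first split=> // [x | x y v].
- by rewrite -fS; exists x.
- by rewrite [x - y]addrC -[- y]scaleN1r flin scaleN1r addrC.
by apply: finj; apply/funext => v; rewrite fM fi II fZ.
Qed.

Lemma split_anticommuting_involution (F : fieldType) (V : lmodType F)
    (S : set (V -> V)) (I : V -> V) (d : F) :
  (2%:R : F) != 0 -> (forall e : F, e * e <> d) ->
  isomorphic_algebra S 'M[F]_2 -> S I -> (forall v, I (I v) = d *: v) ->
  exists J : V -> V,
    [/\ S J, forall v, J (I v) = - I (J v) & forall v, J (J v) = v].
Proof.
move=> two_neq0 nsq iso SI II.
have [f [i [[fS fM fZ fB fi] ii]]] := isomorphic_algebra_lift iso SI II.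
have [s [ss is_]] := matrix_anticommuting_involution two_neq0 ii nsq.
have f1 v : f 1 v = v by rewrite -[1]scale1r fZ scale1r.
have f0 v : f 0 v = 0 by rewrite -[0](subrr 0) fB subrr.
exists (f s); split=> // v; last by rewrite -fM ss f1.
by rewrite -fi -!fM is_ -[- (s * i)]sub0r fB f0 sub0r opprK.
Qed.

(** Bijectivity is the form in which [J^2] not being a norm is used: it lets
    [J^2 - N] be cancelled on either side of an intertwining map. *)
Lemma division_anticommuting (F : fieldType) (V : lmodType F)
    (S : set (V -> V)) (D : falgType F) (I : V -> V) (d : F) :
  (2%:R : F) != 0 -> (forall e : F, e * e <> d) ->
  quaternion_division_algebra D -> isomorphic_algebra S D ->
  S I -> (forall v, I (I v) = d *: v) ->
  exists J : V -> V,
    [/\ S J, forall v, J (I v) = - I (J v)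
      & forall a b : F,
          bijective (fun v => J (J v) - (a * a - d * (b * b)) *: v)].
Proof.
move=> two_neq0 nsq quatD iso SI II.
have [f [i [[fS fM fZ fB fi] ii]]] := isomorphic_algebra_lift iso SI II.
have [j [j_neq0 ij]] := quaternion_anticommuting quatD ii nsq.
have [_ _ Dunit] := quatD.
have f1 v : f 1 v = v by rewrite -[1]scale1r fZ scale1r.
have f0 v : f 0 v = 0 by rewrite -[0](subrr 0) fB subrr.
exists (f j); split=> // [v | a b].
  by rewrite -fi -!fM ij -[- (j * i)]sub0r fB f0 sub0r opprK.
have i_neq0 : i != 0.
  apply/eqP => i0; apply: (nsq 0); rewrite mul0r.
  by apply: (fmorph_inj (in_alg D)); rewrite rmorph0 /= -ii i0 mul0r.
pose N := a * a - d * (b * b).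
have /Dunit u : j * j - N%:A != 0.
  rewrite subr_eq0; apply/eqP.
  exact: (anticommuting_sq_not_norm two_neq0 Dunit ii i_neq0 j_neq0 ij).
have fu v : f j (f j v) - N *: v = f (j * j - N%:A) v by rewrite fB fM fZ.
by exists (f (j * j - N%:A)^-1) => v; rewrite fu -fM ?mulVr ?mulrV // f1.
Qed.

(** * Comparison along a multiplicity-one intertwiner *)

(** From [J T J0 = c T] one gets [J^2 T J0^2 = J c T J0 = c^* (J T J0)
    = c^* c T], where [c^* = a - b i] is the conjugate of [c = a + b i]. *)
Lemma intertwiner_norm (F : fieldType) (F' : fieldExtType F) (n : nat)
    (B : gl_eqs F n) (V W : coaction F' n) (T : V -> W) (i : F') (d : F)
    (J0 : coaction_res (in_alg F') V -> coaction_res (in_alg F') V)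
    (J : coaction_res (in_alg F') W -> coaction_res (in_alg F') W) :
  i * i = d%:A -> (forall c : F', exists a b : F, c = a%:A + b *: i) ->
  B_hom (eqs_ext (in_alg F') B) T ->
  (forall T', B_hom (eqs_ext (in_alg F') B) T' ->
     exists c, forall v, T' v = c *: T v) ->
  B_hom B J0 -> (forall v : V, J0 (i *: v) = - (i *: (J0 v : V))) ->
  B_hom B J -> (forall w : W, J (i *: w) = - (i *: (J w : W))) ->
  exists a b : F, forall v,
    J (J (T (J0 (J0 v)))) =
      (a * a - d * (b * b)) *: (T v : coaction_res (in_alg F') W).
Proof.
move=> ii span hT uniqT hJ0 J0i hJ Ji.
have [lT resT] := (B_hom_res _ _ _).1 hT.
have JZ (U : coaction F' n)
    (L : coaction_res (in_alg F') U -> coaction_res (in_alg F') U) :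
    B_hom B L -> (forall w : U, L (i *: w) = - (i *: (L w : U))) ->
    forall (a b : F) (w : U),
      L ((a%:A + b *: i) *: w) = (a%:A - b *: i) *: (L w : U).
  move=> [lL _] Li a b w.
  have LZ (c : F) (x : U) : L (c%:A *: x) = c%:A *: (L x : U) :=
    linear_mapZ lL c x.
  have bi (x : U) : (b *: i) *: x = b%:A *: (i *: x).
    by rewrite scalerA mulr_algl.
  rewrite scalerDl (linear_mapD lL) scalerBl !bi !LZ Li.
  by rewrite scalerN.
have [c cE] : exists c, forall v, (J \o T \o J0) v = c *: T v.
  apply: uniqT; apply/B_hom_res; split; last first.
    by apply: (B_hom_comp (B_hom_comp hJ resT)).
  move=> c v w; have [a [b ->]] := span c.
  have [[lJ _] [lJ0 _]] := (hJ, hJ0).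
  rewrite /= (linear_mapD lJ0) (linear_mapD lT) (linear_mapD lJ).
  rewrite (JZ _ _ hJ0 J0i) -scaleNr (linear_mapZ lT) (JZ _ _ hJ Ji).
  by rewrite scaleNr opprK.
have [a [b cab]] := span c; exists a, b => v.
have -> : J (T (J0 (J0 v))) = c *: T (J0 v) := cE (J0 v).
rewrite cab (JZ _ _ hJ Ji).
have -> : J (T (J0 v)) = c *: T v := cE v.
rewrite cab scalerA -[RHS]/((a * a - d * (b * b))%:A *: (T v : W)).
congr (_ *: (_ : W)).
rewrite mulrBl !mulrDr !mulr_algl -!scalerAl -!scalerAr ii mulr1.
rewrite !scalerA scalerBl [b * b * d]mulrC.
by rewrite [a * b]mulrC opprD addrA addrK.
Qed.

(** * The Frobenius-Schur indicators agree *)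

Lemma FS_neq0 (F : fieldType) (F' : fieldExtType F) (V : lmodType F)
    (S : set (V -> V)) :
  FS F' S <> 0 ->
  FS F' S = 1 /\ isomorphic_algebra S 'M[F]_2 \/
  FS F' S = -1 /\ exists D : falgType F,
    quaternion_division_algebra D /\ isomorphic_algebra S D.
Proof.
rewrite /FS; case: xgetP => [e -> [[-> ?]|[->]|[-> ?]] | //] _.
- by left.
- by [].
by right.
Qed.

Theorem proposition5p8 (F : fieldType) (hF : [pchar F] =i pred0)
    (P : pair F) (hP : is_pair P) (hQ : condition_Q (grp P))
    (F' : fieldExtType F) (hF' : \dim {:F'} = 2%N)
    (X : abmodule (pair_ext (in_alg F') P)) (hX : is_abmodule X)
    (hXirr : ab_absolutely_irreducible X) (hXFS : FS_ab X <> 0)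
    (X0 : coaction F' (dim_B P))
    (hX0 : rational_module (grp (pair_ext (in_alg F') P)) X0)
    (hX0irr : B_absolutely_irreducible (grp (pair_ext (in_alg F') P)) X0)
    (hmult : multiplicity_one (grp (pair_ext (in_alg F') P)) X0 X)
    (hX0FS : FS_B (grp P) X0 <> 0) :
  FS_ab X = FS_B (grp P) X0.
Proof.
have two_neq0 : (2%:R : F) != 0.
  by have := hF 2%N; rewrite !inE /= => /negbT.
have [i [d [ii nsq span]]] := quadratic_generator two_neq0 hF'.
have [ratX [actX _] _ _ _] := hX.
have [T [hT [v0 Tv0] uniqT]] := hmult.
have iiZ (V : lmodType F') (v : V) : i *: (i *: v) = d%:A *: v.
  by rewrite scalerA ii.
pose IX : ab_res X -> ab_res X := fun v => i *: (v : X).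
pose I0 : coaction_res (in_alg F') X0 -> coaction_res (in_alg F') X0 :=
  fun v => i *: (v : X0).
have SX : ab_end (X := ab_res X) IX.
  split; first exact (@B_hom_scale F F' (in_alg F') _ (grp P) _ X i ratX).
  by move=> x v; rewrite /IX /= (linear_mapZ (actX _)).
have S0 : B_hom (grp P) I0.
  exact (@B_hom_scale F F' (in_alg F') _ (grp P) _ X0 i hX0).
have [] := FS_neq0 hXFS; have [] := FS_neq0 hX0FS.
- by move=> [e0 _] [eX _]; rewrite /FS_ab /FS_B e0 eX.
  (* [J] is an involution, so [J0^2 - N] maps onto the kernel of [T]. *)
- move=> [_ [D [quatD isoD]]] [_ isoM].
  have [J [[hJ _] Ji JJ]] :=
    split_anticommuting_involution two_neq0 nsq isoM SX (iiZ X).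
  have [J0 [hJ0 J0i bij]] :=
    division_anticommuting two_neq0 nsq quatD isoD S0 (iiZ X0).
  have [a [b N]] := intertwiner_norm ii span hT uniqT hJ0 J0i hJ Ji.
  have [K _ KK] := bij a b.
  have [_ [lT _]] := (B_hom_res _ _ _).1 hT.
  case: Tv0; rewrite -(KK v0) (linear_mapB lT) (linear_mapZ lT).
  by rewrite -N !JJ subrr.
  (* [J0] is an involution, so [J^2 - N] kills the image of [T]. *)
- move=> [_ isoM] [_ [D [quatD isoD]]].
  have [J0 [hJ0 J0i JJ]] :=
    split_anticommuting_involution two_neq0 nsq isoM S0 (iiZ X0).
  have [J [[hJ _] Ji bij]] :=
    division_anticommuting two_neq0 nsq quatD isoD SX (iiZ X).
  have [a [b N]] := intertwiner_norm ii span hT uniqT hJ0 J0i hJ Ji.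
  have lJ : linear_map J := hJ.1.
  case: Tv0; apply: (bij_inj (bij a b)).
  by rewrite -N !JJ subrr !(linear_map0 lJ) scaler0 subrr.
by move=> [e0 _] [eX _]; rewrite /FS_ab /FS_B e0 eX.
Qed.
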